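(* Let $a,b,c,d,e,f$ be nonzero integers. Regard $a$ and $b$ as partners, $c$ and $d$ as partners, and $e$ and $f$ as partners, and suppose that at least one of $a,\dots,f$ divides its partner. Then the triangle of groups $G(a,b;c,d;e,f)$ is not developable, except when, after applying a finite sequence of trivial moves, the parameter tuple $(a,b;c,d;e,f)$ has one of the following five forms (where $a,b,c,e$ denote nonzero integers): \begin{enumerate} \item $(a,-a;\,c,-c;\,e,-e)$; \item $(a,b;\,c,c;\,e,e)$; \item $(a,b;\,c,c;\,e,-e)$ with $a\equiv b \pmod 2$; \item $(a,b;\,c,-c;\,e,e)$ with $e$ even; \item $(a,b;\,c,-c;\,e,-e)$ with $e$ even and $a\equiv b\pmod 2$. \end{enumerate} In all of these exceptional cases the triangle of groups is developable.
   Context: Conjugation convention: $x^y=y^{-1}xy$. For nonzero integers $a,\dots,f$, $$G(a,b;c,d;e,f)=\bigl\langle x,y,z \bigm| (x^a)^y=x^b,\ (y^c)^z=y^d,\ (z^e)^x=z^f\bigr\rangle .$$ This group is regarded as (the direct limit of) the triangle of groups with vertex groups the Baumslag-Solitar groups $\langle x,y\mid (x^a)^y=x^b\rangle$, $\langle y,z\mid (y^c)^z=y^d\rangle$, $\langle z,x\mid (z^e)^x=z^f\rangle$, edge groups the infinite cyclic groups $\langle x\rangle,\langle y\rangle,\langle z\rangle$, and trivial face group, with the obvious inclusions. The triangle $G(a,b;c,d;e,f)$ is called developable if each of the three vertex groups injects, under the natural map, into the direct limit, i.e. into the group $G(a,b;c,d;e,f)$. Trivial moves on parameter tuples: (i)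 cyclic permutation of the three pairs $(a,b),(c,d),(e,f)$; (ii) exchange of one of $a,\dots,f$ with its partner (i.e. swapping the two entries of one pair); (iii) simultaneous negation of one of $a,\dots,f$ and its partner (i.e. negating both entries of one pair). *)

(* Defs.v *)
From HB Require Import structures.
From mathcomp Require Import all_boot all_order all_algebra.
From mathcomp Require Import boolp.
Set Implicit Arguments.
Unset Strict Implicit.
Unset Printing Implicit Defensive.

Local Open Scope group_scope.
Local Open Scope quotient_scope.

(* Groups given by generators and relations.  A letter (g, false) stands for
   the generator g and (g, true) for its formal inverse; a presentation is a
   finite list of equations between words. *)

Definition word (X : Type) : Type := seq (X * bool).

Definition winv (X : Type) (w : word X) : word X :=
  rev [seq (l.1, ~~ l.2) | l <- w].

Definition wpow (X : Type) (g : X) (n : int) : word X :=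
  match n with
  | Posz k => nseq k (g, false)
  | Negz k => nseq k.+1 (g, true)
  end.

Section Presentation.
Variables (X : choiceType) (E : seq (word X * word X)).

Inductive word_eq : word X -> word X -> Prop :=
| WordRefl u : word_eq u u
| WordSym u v : word_eq u v -> word_eq v u
| WordTrans u v w : word_eq u v -> word_eq v w -> word_eq u w
| WordCat u u' v v' :
    word_eq u u' -> word_eq v v' -> word_eq (u ++ v) (u' ++ v')
| WordCancel g s : word_eq [:: (g, s); (g, ~~ s)] [::]
| WordRel u v : (u, v) \in E -> word_eq u v.

Definition word_eqb : rel (word X) := fun u v => `[< word_eq u v >].

Lemma word_eqb_refl : reflexive word_eqb.
Proof. by move=> u; apply/asboolP; exact: WordRefl. Qed.

Lemma word_eqb_sym : symmetric word_eqb.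
Proof. by move=> u v; apply/asboolP/asboolP; exact: WordSym. Qed.

Lemma word_eqb_trans : transitive word_eqb.
Proof.
by move=> v u w /asboolP uv /asboolP vw; apply/asboolP; exact: WordTrans vw.
Qed.

Canonical word_eqb_equiv :=
  EquivRel word_eqb word_eqb_refl word_eqb_sym word_eqb_trans.

Definition presented : Type := {eq_quot word_eqb}.
HB.instance Definition _ := Choice.on presented.
HB.instance Definition _ := EqQuotient.on presented.

Definition wclass (w : word X) : presented := \pi_presented w.

Lemma wclassP u v : wclass u = wclass v <-> word_eq u v.
Proof.
rewrite /wclass; split=> [/eqP|uv]; last first.
  by apply/eqP; rewrite eqmodE; apply/asboolP.
by rewrite eqmodE => /asboolP.
Qed.

Lemma wclass_repr p : wclass (repr p) = p.
Proof. exact: reprK. Qed.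

Lemma word_eq_repr w : word_eq (repr (wclass w)) w.
Proof. by apply/wclassP; rewrite wclass_repr. Qed.

Lemma winvK : involutive (@winv X).
Proof.
move=> w; rewrite /winv map_rev revK -map_comp -[RHS]map_id.
by apply: eq_map => -[g s] /=; rewrite negbK.
Qed.

Lemma word_eq_catV w : word_eq (w ++ winv w) [::].
Proof.
elim: w => [|[g s] w IHw]; first exact: WordRefl.
rewrite /winv /= rev_cons -cats1 catA -cat_cons.
apply: WordTrans (WordCancel g s); rewrite -cat1s -[[:: _; _]]/([:: _] ++ [:: _]).
rewrite -catA; apply: WordCat; first exact: WordRefl.
by rewrite -[X in word_eq _ X]cat0s; apply: WordCat; last exact: WordRefl.
Qed.

Lemma word_eq_inv u v : word_eq u v -> word_eq (winv u) (winv v).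
Proof.
move=> uv; have e1: word_eq (winv u) (winv u ++ (v ++ winv v)).
  rewrite -[X in word_eq X _]cats0; apply: WordCat; first exact: WordRefl.
  by apply: WordSym; exact: word_eq_catV.
apply: WordTrans e1 _; rewrite catA -[X in word_eq _ X]cat0s.
apply: WordCat; last exact: WordRefl.
apply: WordTrans (_ : word_eq _ (winv u ++ u)) _.
  by apply: WordCat; [exact: WordRefl | exact: WordSym].
by rewrite -[X in _ ++ X]winvK; exact: word_eq_catV.
Qed.

Definition pres_one : presented := wclass [::].
Definition pres_mul (p q : presented) : presented := wclass (repr p ++ repr q).
Definition pres_inv (p : presented) : presented := wclass (winv (repr p)).

Lemma pres_mulE u v : pres_mul (wclass u) (wclass v) = wclass (u ++ v).
Proof. by apply/wclassP; apply: WordCat; exact: word_eq_repr. Qed.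

Lemma pres_invE u : pres_inv (wclass u) = wclass (winv u).
Proof. by apply/wclassP; apply: word_eq_inv; exact: word_eq_repr. Qed.

Lemma pres_mulA : associative pres_mul.
Proof.
move=> p q r; rewrite -(wclass_repr p) -(wclass_repr q) -(wclass_repr r).
by rewrite !pres_mulE catA.
Qed.

Lemma pres_mul1 : left_id pres_one pres_mul.
Proof. by move=> p; rewrite -(wclass_repr p) pres_mulE. Qed.

Lemma pres_mulr1 : right_id pres_one pres_mul.
Proof. by move=> p; rewrite -(wclass_repr p) pres_mulE cats0. Qed.

Lemma pres_mulV : right_inverse pres_one pres_inv pres_mul.
Proof.
move=> p; rewrite -(wclass_repr p) pres_invE pres_mulE.
by apply/wclassP; exact: word_eq_catV.
Qed.

Lemma pres_mulVl : left_inverse pres_one pres_inv pres_mul.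
Proof.
move=> p; rewrite -(wclass_repr p) pres_invE pres_mulE -[X in _ ++ X]winvK.
by apply/wclassP; exact: word_eq_catV.
Qed.

HB.instance Definition _ :=
  isGroup.Build presented pres_mulA pres_mul1 pres_mulr1 pres_mulVl pres_mulV.

Lemma wclassM u v : wclass u * wclass v = wclass (u ++ v).
Proof. exact: pres_mulE. Qed.

Definition pgen (g : X) : presented := wclass [:: (g, false)].

End Presentation.

Section Lift.
Variables (X : choiceType) (E : seq (word X * word X)).
Variables (H : groupType) (h : X -> H).

Definition weval (w : word X) : H :=
  \prod_(l <- w) (if l.2 then (h l.1)^-1 else h l.1).

(* When h satisfies the equations E, this is the homomorphism extending h
   (lemmas pres_lift_wclass and pres_liftM); otherwise it is meaningless. *)
Definition pres_lift (p : presented E) : H := weval (repr p).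

Lemma weval_cat u v : weval (u ++ v) = weval u * weval v.
Proof. by rewrite /weval big_cat. Qed.

Hypothesis hE : forall u v, (u, v) \in E -> weval u = weval v.

Lemma weval_eq u v : word_eq E u v -> weval u = weval v.
Proof.
elim=> // [{}u {}v w _ -> _ -> | {}u u' {}v v' _ IHu _ IHv | g s] //.
  by rewrite !weval_cat IHu IHv.
rewrite /weval !big_cons big_nil; case: s => /=; rewrite mulg1.
  exact: mulVg.
exact: mulgV.
Qed.

Lemma pres_lift_wclass w : pres_lift (wclass E w) = weval w.
Proof. by apply: weval_eq; exact: word_eq_repr. Qed.

Lemma pres_liftM : {morph pres_lift : p q / p * q}.
Proof.
move=> p q; rewrite -(wclass_repr p) -(wclass_repr q) wclassM.
by rewrite !pres_lift_wclass weval_cat.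
Qed.

Lemma pres_lift_gen g : pres_lift (pgen E g) = h g.
Proof. by rewrite pres_lift_wclass /weval big_seq1. Qed.

End Lift.

Lemma weval_pgen (X Y : choiceType) (E : seq (word Y * word Y)) (f : X -> Y) w :
  weval (fun g => pgen E (f g)) w = wclass E [seq (f l.1, l.2) | l <- w].
Proof.
elim: w => [|[g s] w IHw]; first by rewrite /weval big_nil.
rewrite -cat1s weval_cat IHw map_cat -wclassM; congr (_ * _).
rewrite /weval big_seq1 /=; case: s => //.
exact: (pres_invE E [:: (f g, false)]).
Qed.

(* The equation (s^m)^t = s^n, where s^t is t^-1 s t. *)
Definition bs_eqn (X : Type) (s t : X) (m n : int) : word X * word X :=
  (wpow t (- 1)%R ++ wpow s m ++ wpow t 1%R, wpow s n).

Inductive bs_gen := Base | Stable.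
HB.instance Definition _ := gen_eqMixin bs_gen.
HB.instance Definition _ := gen_choiceMixin bs_gen.

Definition BS (m n : int) : groupType :=
  presented [:: bs_eqn Base Stable m n].

Inductive tri_gen := GenX | GenY | GenZ.
HB.instance Definition _ := gen_eqMixin tri_gen.
HB.instance Definition _ := gen_choiceMixin tri_gen.

Definition tri_eqns (a b c d e f : int) : seq (word tri_gen * word tri_gen) :=
  [:: bs_eqn GenX GenY a b; bs_eqn GenY GenZ c d; bs_eqn GenZ GenX e f].

Definition tri_group (a b c d e f : int) : groupType :=
  presented (tri_eqns a b c d e f).

Definition bs_incl (s t : tri_gen) (g : bs_gen) : tri_gen :=
  match g with Base => s | Stable => t end.

Section VertexMaps.
Variables a b c d e f : int.
Let gen := pgen (tri_eqns a b c d e f).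

Definition vertex_xy : BS a b -> tri_group a b c d e f :=
  pres_lift (fun g => gen (bs_incl GenX GenY g)).

Definition vertex_yz : BS c d -> tri_group a b c d e f :=
  pres_lift (fun g => gen (bs_incl GenY GenZ g)).

Definition vertex_zx : BS e f -> tri_group a b c d e f :=
  pres_lift (fun g => gen (bs_incl GenZ GenX g)).

Lemma bs_incl_eqn s t m n : bs_eqn s t m n \in tri_eqns a b c d e f ->
  forall u v, (u, v) \in [:: bs_eqn Base Stable m n] ->
    weval (fun g => gen (bs_incl s t g)) u =
    weval (fun g => gen (bs_incl s t g)) v.
Proof.
move=> st u v; rewrite inE => /eqP uv.
rewrite (congr1 fst uv : u = _) (congr1 snd uv : v = _) !weval_pgen.
have mapP g n0 : [seq (bs_incl s t l.1, l.2) | l <- wpow g n0] =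
    wpow (bs_incl s t g) n0 by case: n0 => k; rewrite map_nseq.
by apply/wclassP; apply: WordRel; rewrite !map_cat !mapP.
Qed.

Lemma tri_eqn_xy : bs_eqn GenX GenY a b \in tri_eqns a b c d e f.
Proof. by rewrite !inE eqxx. Qed.

Lemma tri_eqn_yz : bs_eqn GenY GenZ c d \in tri_eqns a b c d e f.
Proof. by rewrite !inE eqxx orbT. Qed.

Lemma tri_eqn_zx : bs_eqn GenZ GenX e f \in tri_eqns a b c d e f.
Proof. by rewrite !inE eqxx !orbT. Qed.

HB.instance Definition _ := isMultiplicative.Build _ _ vertex_xy
  (pres_liftM (bs_incl_eqn tri_eqn_xy)).
HB.instance Definition _ := isMultiplicative.Build _ _ vertex_yz
  (pres_liftM (bs_incl_eqn tri_eqn_yz)).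
HB.instance Definition _ := isMultiplicative.Build _ _ vertex_zx
  (pres_liftM (bs_incl_eqn tri_eqn_zx)).

Lemma vertex_xyE g : vertex_xy (pgen _ g) = gen (bs_incl GenX GenY g).
Proof. exact: pres_lift_gen (bs_incl_eqn tri_eqn_xy) g. Qed.

Lemma vertex_yzE g : vertex_yz (pgen _ g) = gen (bs_incl GenY GenZ g).
Proof. exact: pres_lift_gen (bs_incl_eqn tri_eqn_yz) g. Qed.

Lemma vertex_zxE g : vertex_zx (pgen _ g) = gen (bs_incl GenZ GenX g).
Proof. exact: pres_lift_gen (bs_incl_eqn tri_eqn_zx) g. Qed.

Definition developable : Prop :=
  [/\ injective vertex_xy, injective vertex_yz & injective vertex_zx].

End VertexMaps.

Local Open Scope ring_scope.

Definition params : Type := (int * int) * (int * int) * (int * int).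

Definition swap (p : int * int) : int * int := (p.2, p.1).
Definition negate (p : int * int) : int * int := (- p.1, - p.2).

Inductive trivial_move : params -> params -> Prop :=
| MoveCycle p q r : trivial_move (p, q, r) (q, r, p)
| MoveSwap1 p q r : trivial_move (p, q, r) (swap p, q, r)
| MoveSwap2 p q r : trivial_move (p, q, r) (p, swap q, r)
| MoveSwap3 p q r : trivial_move (p, q, r) (p, q, swap r)
| MoveNeg1 p q r : trivial_move (p, q, r) (negate p, q, r)
| MoveNeg2 p q r : trivial_move (p, q, r) (p, negate q, r)
| MoveNeg3 p q r : trivial_move (p, q, r) (p, q, negate r).

Inductive trivial_moves : params -> params -> Prop :=
| Moves0 p : trivial_moves p p
| MovesS p q r : trivial_move p q -> trivial_moves q r -> trivial_moves p r.

Definition exceptional_form (p : params) : Prop :=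
  exists a b c e : int, [/\ a != 0, b != 0, c != 0 & e != 0] /\
  [\/ p = ((a, - a), (c, - c), (e, - e)),
      p = ((a, b), (c, c), (e, e)),
      p = ((a, b), (c, c), (e, - e)) /\ (a = b %[mod 2])%Z |
      (p = ((a, b), (c, - c), (e, e)) /\ (2 %| e)%Z) \/
      [/\ p = ((a, b), (c, - c), (e, - e)), (2 %| e)%Z & (a = b %[mod 2])%Z]].

Definition exceptional (p : params) : Prop :=
  exists2 q, trivial_moves p q & exceptional_form q.

(* Main.v *)
From HB Require Import structures.
Require Import Defs.
From mathcomp Require Import all_boot all_order all_algebra.
From mathcomp Require Import zify ring.
From mathcomp Require Import boolp.
Set Implicit Arguments.
Unset Strict Implicit.
Unset Printing Implicit Defensive.
Import Order.TTheory GRing.Theory Num.Theory.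
Local Open Scope ring_scope.
Local Open Scope group_scope.

(** Tuples are studied through elements [x], [y], [z] of arbitrary groups that
    satisfy the three relations.

    Failure of developability.  If the vertex groups embed, then the exponent of
    the stable letter is well defined on each of the subgroups <x,y>, <y,z> and
    <z,x>, because it is well defined on a Baumslag-Solitar group; this is all that
    is used ([graded_triple]).  Suppose [a] divides [b], [|c| <> |d|] and
    [|e| <> |f|].  A power [u] of [x] satisfies [u ^ y = u ** k] with [k = b / a],
    and [(z ** p) ^ u = z ** q] with [p <> q], which says also that
    [u ^ (z ** p) = u * z ** (p - q)].  Conjugating this identity by a suitable
    power of [y], which both [z ** p] and [z ** (p - q)] carry to powers of [y],
    expresses a nontrivial power [y ** M] as an element of <z,x>
    ([dvd_forces_power_in_vertex]).  This element conjugates some [x ** i] to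
    [x ** j], and the exponent of [x] gives [i = j]; hence [|a| = |b|], and in that
    case the same computation gives [y ** M = 1], which is impossible too.  If
    [d = c] or [d = -c], and [f = e] or [f = -e], while [|a| <> |b|], then short
    conjugation arguments force the parity conditions of the exceptional list
    ([graded_triple_two_equal]).

    Developability.  It suffices to detect each nontrivial element of each vertex
    group in some group containing a triple with the required relations.  Up to
    cyclic permutation the exceptional tuples are those with
    [b = -a], [d = -c], [f = -e], and those with
    [d = c], or [d = -c] and [e] even, together with
    [f = e], or [f = -e] and [a = b] modulo 2.  Most vertex groups are retracts, or
    embed after adjoining an involution that inverts the Stable letter (acting on one
    or on two copies of the vertex group).  The vertex group <z,x> in the second case has
    Base letter [z] with [z ** e] normal; its elements have a normal form of free
    product type, and this is detected by a linear representation in which the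
    Stable letter acts by [1 + X] with [X * X = 0] and [y] scales [X]
    ([detected_by_layers]). *)

(** * Integer powers and conjugation relations *)

Definition zpow (H : groupType) (x : H) (n : int) : H :=
  match n with Posz k => x ^+ k | Negz k => x ^- k.+1 end.

Local Notation "x ** n" := (zpow x n%R)
  (at level 29, left associativity) : group_scope.

Section IntegerPowers.
Variable H : groupType.
Implicit Types (x y : H) (m n : int).

Lemma zpow1 x : x ** 1 = x. Proof. exact: expg1. Qed.

Lemma zpowS x n : x ** (n + 1) = x ** n * x.
Proof.
case: n => [k|[|k]].
- have -> : (Posz k + 1 = Posz k.+1)%R by lia.
  exact: expgSr.
- by rewrite /= expg1 mulVg.
have ->: (Negz k.+1 + 1)%R = Negz k by rewrite !NegzE; lia.
by rewrite /= (expgS _ k.+1) invgM mulgVK.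
Qed.

Lemma zpow_pred x n : x ** (n - 1) = x ** n * x^-1.
Proof. by rewrite -[in RHS](subrK 1%R n) zpowS mulgK. Qed.

(** The remaining laws of exponents, and the formulas for the powers of concrete
    permutations below, are instances of this uniqueness of morphisms from the
    integers. *)
Lemma zpow_unique (h : int -> H) x :
  (forall n, h (n + 1)%R = h n * x) -> h 0%R = 1 -> forall n, h n = x ** n.
Proof.
move=> hS h0; elim/int_rect=> [//|n IH|n IH].
  have -> : (Posz n.+1 = Posz n + 1)%R by lia.
  by rewrite hS IH zpowS.
have -> : (- Posz n.+1 = - Posz n - 1)%R by lia.
by apply: (mulIg x); rewrite zpow_pred -hS subrK mulgVK.
Qed.

Lemma zpowD x m n : x ** (m + n) = x ** m * x ** n.
Proof.
suff -> : x ** n = (x ** m)^-1 * x ** (m + n) by rewrite mulVKg.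
symmetry; apply: (zpow_unique (h := fun n => (x ** m)^-1 * x ** (m + n))).
  by move=> k; rewrite addrA zpowS mulgA.
by rewrite addr0 mulVg.
Qed.

Lemma zpowN x n : x ** (- n) = (x ** n)^-1.
Proof. by apply: (mulgI (x ** n)); rewrite -zpowD subrr mulgV. Qed.

Lemma zpowB x m n : x ** (m - n) = x ** m * (x ** n)^-1.
Proof. by rewrite zpowD zpowN. Qed.

Lemma zpowM x m n : x ** (m * n) = (x ** m) ** n.
Proof.
apply: (zpow_unique (h := fun n => x ** (m * n))) => [k|].
  by rewrite mulrDr mulr1 zpowD.
by rewrite mulr0.
Qed.

Lemma zpowJ x y n : (x ** n) ^ y = (x ^ y) ** n.
Proof.
apply: (zpow_unique (h := fun n => (x ** n) ^ y)) => [k|]; last exact: conj1g.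
by rewrite zpowS conjMg.
Qed.

Lemma zpow_one n : (1 : H) ** n = 1.
Proof.
by symmetry; apply: (zpow_unique (h := fun=> 1)) => // k; rewrite mulg1.
Qed.

Lemma zpowV x n : x^-1 ** n = (x ** n)^-1.
Proof. by rewrite -zpowN -mulN1r zpowM zpowN zpow1. Qed.

Lemma zpow_even x n : x * x = 1 -> (2 %| n)%Z -> x ** n = 1.
Proof.
move=> x2 /dvdzP[k ->]; rewrite mulrC zpowM.
by rewrite [x ** 2]x2 zpow_one.
Qed.

Lemma zpow_mod2 x m n : x * x = 1 -> (m = n %[mod 2])%Z -> x ** m = x ** n.
Proof.
move=> x2 mn; rewrite -(subrK n m) zpowD zpow_even ?mul1g //.
by lia.
Qed.

End IntegerPowers.

Definition bs_rel (H : groupType) (s t : H) (m n : int) : Prop :=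
  (s ** m) ^ t = s ** n.

Definition tri_rel (H : groupType) (x y z : H) (a b c d e f : int) : Prop :=
  [/\ bs_rel x y a b, bs_rel y z c d & bs_rel z x e f].

Section BSRelations.
Variable H : groupType.
Implicit Types (s t : H) (m n k : int) (i : nat).

Lemma bs_rel_swap s t m n : bs_rel s t m n -> bs_rel s t^-1 n m.
Proof. by rewrite /bs_rel => <-; rewrite conjgK. Qed.

Lemma bs_rel_inv s t m n : bs_rel s t m n -> bs_rel s^-1 t m n.
Proof. by rewrite /bs_rel !zpowV conjVg => ->. Qed.

Lemma bs_rel_mul s t m n k : bs_rel s t m n -> bs_rel s t (m * k) (n * k).
Proof. by move=> st; rewrite /bs_rel !zpowM zpowJ st. Qed.

Lemma bs_rel_comp s t t' m n k :
  bs_rel s t m n -> bs_rel s t' n k -> bs_rel s (t * t') m k.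
Proof. by rewrite /bs_rel conjgM => ->. Qed.

(** Starting from a common multiple of the exponents met on the way, the relation
    can be applied [i] times in succession. *)
Lemma bs_rel_iter s t m n i :
  bs_rel s t m n -> bs_rel s (t ^+ i) (m ^+ i)%R (n ^+ i)%R.
Proof.
move=> st; elim: i => [|i IH]; first by rewrite /bs_rel !expr0 expg0 conjg1.
rewrite !exprS (expgS t); apply: bs_rel_comp (bs_rel_mul _ st) _.
by rewrite ![(n * _)%R]mulrC; exact: bs_rel_mul.
Qed.

Lemma bs_rel_opp s t m n : bs_rel s t m n -> bs_rel s t (- m) (- n).
Proof. by move/(bs_rel_mul (-1)); rewrite !mulrN1. Qed.

Lemma bs_rel_absz s t m : bs_rel s t m m -> bs_rel s t `|m|%N `|m|%N.
Proof. by case: m => // n st; exact: (bs_rel_opp st). Qed.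

Lemma bs_rel_absN s t m :
  bs_rel s t m (- m) -> bs_rel s t `|m|%N (- Posz `|m|%N).
Proof. by case: m => // n st; exact: (bs_rel_opp st). Qed.

Lemma bs_rel_commute s t m k : bs_rel s t m m -> bs_rel s (t ** k) m m.
Proof.
have fixE u : bs_rel s u m m <-> commute (s ** m) u.
  by split=> [/conjg_fixP/commgP | /commgP/conjg_fixP].
move=> /fixE st; apply/fixE.
by case: k => k /=; [|apply: commuteV]; exact: commuteX.
Qed.

Lemma bs_rel_invert_sq s t m : bs_rel s t m (- m) -> bs_rel s (t ** 2) m m.
Proof.
by move=> st; have := bs_rel_opp st; rewrite opprK; exact: bs_rel_comp.
Qed.

Lemma bs_rel_invert_even s t m k :
  bs_rel s t m (- m) -> (2 %| k)%Z -> bs_rel s (t ** k) m m.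
Proof.
move=> st /dvdzP[j ->]; rewrite mulrC zpowM.
exact: bs_rel_commute (bs_rel_invert_sq st).
Qed.

Lemma bs_rel_invert_odd s t m k :
  bs_rel s t m (- m) -> ~~ (2 %| k)%Z -> bs_rel s (t ** k) m (- m).
Proof.
move=> st k2; have -> : k = (k - 1 + 1)%R by lia.
rewrite zpowD zpow1; refine (bs_rel_comp (bs_rel_invert_even st _) st).
by lia.
Qed.

End BSRelations.

(** * Collapse of triples with a well-defined stable exponent *)

Section Height.
Variables (H : groupType) (s t : H).
Implicit Types (g h : H) (m n k : int).

(** The exponent sum of [t] in the elements of <s,t>.  It is a relation because an
    element can be written in several ways. *)
Inductive height : H -> int -> Prop :=
| HeightBase : height s 0%R
| HeightStable : height t 1%R
| HeightMul g h m n : height g m -> height h n -> height (g * h) (m + n)%R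
| HeightInv g m : height g m -> height g^-1 (- m)%R.

(** The exponent sum of [t] is well defined on <s,t>; it suffices to ask this of
    the neutral element. *)
Definition graded : Prop := forall n, height 1 n -> n = 0%R.

Lemma height1 : height 1 0.
Proof.
rewrite -(mulgV s) -(subrr (0 : int)%R).
by apply: HeightMul; [|apply: HeightInv]; exact: HeightBase.
Qed.

Lemma height_zpow g m n : height g m -> height (g ** n) (m * n)%R.
Proof.
move=> gm; elim/int_rect: n => [|n IH|n IH].
- by rewrite mulr0; exact: height1.
- have -> : (Posz n.+1 = Posz n + 1)%R by lia.
  by rewrite zpowS mulrDr mulr1; exact: HeightMul.
- have -> : (- Posz n.+1 = - Posz n - 1)%R by lia.
  by rewrite zpow_pred mulrBr mulr1; apply: HeightMul => //; exact: HeightInv.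
Qed.

Lemma height_stable_zpow n : height (t ** n) n.
Proof. by rewrite -[X in height _ X]mul1r; apply/height_zpow/HeightStable. Qed.

Lemma graded_stable_free n : graded -> t ** n = 1 -> n = 0%R.
Proof. by move=> gr tn1; apply: gr; rewrite -tn1; exact: height_stable_zpow. Qed.

Lemma graded_conj g m p q :
  graded -> height g m -> (t ** p) ^ g = t ** q -> p = q.
Proof.
move=> gr gm tpq; apply/eqP; rewrite -subr_eq0; apply/eqP/gr.
have ht := height_stable_zpow.
rewrite -(mulgV (t ** q)) -{1}tpq conjgE.
have -> : (p - q = (- m + (p + m)) - q)%R by lia.
apply: HeightMul (HeightInv (ht q)).
exact: HeightMul (HeightInv gm) (HeightMul (ht p) gm).
Qed.

End Height.

(** Besides the relations, the only consequence of developability that the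
    collapse arguments need. *)
Definition graded_triple (H : groupType) (x y z : H) (a b c d e f : int) :=
  tri_rel x y z a b c d e f /\ [/\ graded x y, graded y z & graded z x].

Lemma graded_triple_rot (H : groupType) (x y z : H) a b c d e f :
  graded_triple x y z a b c d e f -> graded_triple y z x c d e f a b.
Proof. by case=> -[? ? ?] [? ? ?]. Qed.

Section Generic.
Variable H : groupType.
Implicit Types (x y z u : H) (a b c d e f : int).

(** A relation in which [u] conjugates powers of [z], read as a formula for a
    conjugate of [u]. *)
Lemma conj_zpow_twist u z p q :
  bs_rel z u p q -> u ^ (z ** p) = u * z ** (p - q).
Proof.
move=> zu; have -> : (p - q = - q + p)%R by lia.
by rewrite zpowD zpowN -zu conjgE /conjg !invgM !invgK !mulgA mulgV mul1g.
Qed.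

Lemma bs_rel_zpow (s t : H) (m n N : int) : bs_rel s t m n ->
  N != 0%R -> m != 0%R -> n != 0%R -> `|m|%N != `|n|%N ->
  exists m' n', [/\ bs_rel s (t ** N) m' n', m' != 0%R & `|m'|%N != `|n'|%N].
Proof.
move=> st N0 m0 n0 mn.
have dif (i : nat) : (0 < i)%N -> `|(m ^+ i)%R|%N != `|(n ^+ i)%R|%N.
  by move=> i0; rewrite !abszX eqn_exp2r.
case: N N0 => i i0.
  exists (m ^+ i)%R, (n ^+ i)%R; split; rewrite ?expf_neq0 //.
    exact: bs_rel_iter.
  by rewrite dif; lia.
exists (n ^+ i.+1)%R, (m ^+ i.+1)%R; split; rewrite ?expf_neq0 //; last first.
  by rewrite eq_sym dif.
by apply: bs_rel_swap; exact: bs_rel_iter.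
Qed.

Lemma expr_even_Posz (m : int) (i : nat) : ~~ odd i ->
  (m ^+ i)%R = Posz (`|m| ^ i).
Proof. by move=> ei; rewrite -abszX gez0_abs // exprn_even_ge0. Qed.

(** With [u = x ** A], [z] satisfies [(z ** p) ^ u = z ** q], so
    [u ^ (z ** p) = u * z ** N] where [N = p - q].  As [u ^ y = u ** k], conjugating
    by [y ** C] on the left-hand side, and by its image [y ** D] under [z ** p] on
    the right-hand side, gives
    [(u * z ** N) ^ (y ** D) = (u * z ** N) ** (k ^ C)].  On the left
    [(z ** N) ^ (y ** D)] equals [z ** N] times a power of [y], nontrivial because
    [|c| <> |d|]; solving for it puts it in <z,x>. *)
Lemma dvd_forces_power_in_vertex x y z a b c d e f :
    tri_rel x y z a b c d e f ->
    a != 0%R -> c != 0%R -> d != 0%R -> (a %| b)%Z ->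
    `|c|%N != `|d|%N -> `|e|%N != `|f|%N ->
  exists M : int, [/\ M != 0%R, exists n, height z x (y ** M) n
                    & `|a|%N = `|b|%N -> y ** M = 1].
Proof.
move=> [xy yz zx] a0 c0 d0 /dvdzP[k bE] cd ef.
(* The factors 2 make the exponents [p], [q], [C] and [D] natural numbers whatever
   the signs of [c], [d], [e] and [f], and make [C] and [D] even. *)
pose A := (2 * `|a|)%N; pose u := x ^+ A.
have uy : bs_rel u y 1 k.
  have /(bs_rel_mul (2 * sgz a)%R) := xy.
  rewrite bE /bs_rel zpow1 (_ : a * (2 * sgz a) = Posz A)%R; last by lia.
  rewrite (_ : k * a * (2 * sgz a) = Posz A * k)%R; last by lia.
  by rewrite zpowM.
pose p := (2 * `|e| ^ A)%N; pose q := (2 * `|f| ^ A)%N.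
have zu : bs_rel z u p q.
  have /(bs_rel_mul 2%R) := bs_rel_iter A zx.
  have eA : ~~ odd A by rewrite oddM.
  by rewrite !(expr_even_Posz _ eA) ![(_ * 2)%R]mulrC.
have A0 : (0 < A)%N by rewrite /A; lia.
have pq : p != q by rewrite /p /q eqn_pmul2l // eqn_exp2r.
pose N := (Posz p - Posz q)%R; have N0 : N != 0%R by rewrite /N; lia.
have uz : u ^ (z ^+ p) = u * z ** N := conj_zpow_twist zu.
have [m [m' [yN m0 mm']]] := bs_rel_zpow yz N0 c0 d0 cd.
have ep : ~~ odd p by rewrite oddM.
(* [D] is a multiple of [m], so that [z ** N] acts on [y ** D]. *)
pose C := (`|c| ^ p * (2 * `|m| ^ 2))%N.
pose D := (`|d| ^ p * (2 * `|m| ^ 2))%N.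
have yp : bs_rel y (z ^+ p) C D.
  have /(bs_rel_mul (Posz (2 * `|m| ^ 2))) := bs_rel_iter p yz.
  by rewrite !(expr_even_Posz _ ep) -!PoszM.
have eC : ~~ odd C by rewrite /C !oddM andbF.
have eD : ~~ odd D by rewrite /D !oddM andbF.
have mm : (Posz (2 * `|m| ^ 2) = 2 * m * m)%R.
  by rewrite PoszM -expr_even_Posz // expr2 mulrA.
pose t := (2 * m * Posz (`|d| ^ p))%R.
have t0 : t != 0%R.
  by rewrite /t !mulf_neq0 // eqz_nat expn_eq0 absz_eq0 (negPf d0).
have DE : (Posz D = m * t)%R.
  by rewrite /D PoszM mm /t; ring.
have yD : (y ^+ D) ^ (z ** N) = y ** (m' * t).
  by have := bs_rel_mul t yN; rewrite /bs_rel -DE.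
have uC (i : nat) : u ^ (y ^+ i) = u ** (k ^+ i).
  by have := bs_rel_iter i uy; rewrite /bs_rel expr1n zpow1.
have hx : height z x u A := height_stable_zpow z x A.
clearbody t C D N p q u A.
have key : u ** (k ^+ D) * (z ** N * y ** (Posz D - m' * t)) =
           (u * z ** N) ** (k ^+ C).
  have <- : (u * z ** N) ^ (y ^+ D) = (u * z ** N) ** (k ^+ C).
    have <- : (y ^+ C) ^ (z ^+ p) = y ^+ D := yp.
    by rewrite -uz -conjJg uC zpowJ.
  rewrite conjMg uC; congr (_ * _).
  have -> : (Posz D - m' * t = - (m' * t) + Posz D)%R by lia.
  rewrite [y ** _]zpowD [y ** (- _)]zpowN -yD -conjVg.
  by rewrite !conjgE !mulgA mulgV mul1g.
exists (Posz D - m' * t)%R; split.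
- rewrite DE -mulrBl mulf_neq0 // subr_eq0.
  by apply: contraNneq mm' => ->; exact: eqxx.
- have hz : height z x (z ** N) 0.
    by rewrite -(mul0r N); exact: height_zpow (HeightBase z x).
  have -> : y ** (Posz D - m' * t) =
    (z ** N)^-1 * ((u ** (k ^+ D))^-1 * (u * z ** N) ** (k ^+ C)).
    by rewrite -key !mulKg.
  eexists; apply: HeightMul; first exact: HeightInv hz.
  apply: HeightMul; first exact: HeightInv (height_zpow _ hx).
  exact: height_zpow (HeightMul hx hz).
- move=> ab; have k1 (i : nat) : ~~ odd i -> (k ^+ i = 1)%R.
    move=> ei; rewrite expr_even_Posz // (_ : `|k|%N = 1%N) ?exp1n //.
    apply/eqP; rewrite -(eqn_pmul2r (m := `|a|)) ?absz_gt0 //.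
    by rewrite mul1n -abszM -bE ab.
  move: key; rewrite !k1 // !zpow1 => key.
  by apply: (mulgI (z ** N)); apply: (mulgI u); rewrite key mulg1.
Qed.

(** Inverting [y] exchanges [a] and [b], so either divisibility puts a power of [y]
    in <z,x>.  For a positive exponent [M] it conjugates [x ** (a ^ M)] to
    [x ** (b ^ M)], and the exponent of [x] is invariant under this. *)
Lemma graded_triple_not_dvd x y z a b c d e f :
    graded_triple x y z a b c d e f ->
    a != 0%R -> b != 0%R -> c != 0%R -> d != 0%R ->
    (a %| b)%Z \/ (b %| a)%Z ->
    `|c|%N != `|d|%N -> `|e|%N != `|f|%N -> False.
Proof.
move=> [rel [gxy _ gzx]] a0 b0 c0 d0 dvd cd ef.
have [M [M0 [n hn] M1]] : exists M : int,
    [/\ M != 0%R, exists n, height z x (y ** M) n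
      & `|a|%N = `|b|%N -> y ** M = 1].
  case: dvd => dvd; first exact: (dvd_forces_power_in_vertex rel).
  case: (rel) => xy yz zx.
  have rel' : tri_rel x y^-1 z b a c d e f.
    by split=> //; [exact: bs_rel_swap | exact: bs_rel_inv].
  have [M [M0 [n hn] M1]] :=
    dvd_forces_power_in_vertex rel' b0 c0 d0 dvd cd ef.
  exists (- M)%R; rewrite oppr_eq0 zpowN -zpowV; split=> //; first by exists n.
  by move=> ab; apply: M1.
have {n hn} [n hn] : exists n, height z x (y ^+ `|M|%N) n.
  case: M M0 M1 hn => i i0 _ hn; first by exists n.
  by exists (- n)%R; rewrite -[y ^+ _]invgK; exact: HeightInv.
have [ab|ab] := eqVneq `|a|%N `|b|%N; last first.
  case: rel => xy yz zx.
  have /(graded_conj gzx hn) := bs_rel_iter `|M| xy.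
  move=> /(congr1 absz)/eqP.
  by rewrite !abszX eqn_exp2r ?absz_gt0 // (negPf ab).
by case/eqP: M0; exact: graded_stable_free gxy (M1 ab).
Qed.

(** If [a] is even, [x ** (a ^ m)] commutes with [z ** e]; conjugation by [y ^+ m]
    fixes [z ** e] and turns this power of [x] into [x ** (b ^ m)], which would
    invert [z ** e] if [b] were odd. *)
Lemma even_of_commuting_powers x y z a b e (m : nat) :
    bs_rel x y a b -> bs_rel z x e (- e) -> bs_rel (z ** e) (y ^+ m) 1 1 ->
    (forall n, z ** n = 1 -> n = 0%R) -> e != 0%R -> (0 < m)%N ->
  (2 %| a)%Z -> (2 %| b)%Z.
Proof.
move=> xy zx zy ztf e0 m0 a2; apply: contraT => b2.
have [j bE] : exists j, (b ^+ m = 2 * j + 1)%R.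
  exists ((b ^+ m)%R %/ 2)%Z.
  rewrite {1}(divz_eq (b ^+ m)%R 2) mulrC; congr (_ + _)%R.
  have : ~~ (2 %| (b ^+ m)%R)%Z.
    by rewrite dvdzE abszX Euclid_dvdX // m0 andbT -dvdzE.
  by lia.
have zxa : bs_rel z (x ** (a ^+ m)) e e.
  by apply: bs_rel_invert_even zx _; exact: dvdz_exp.
have zxb : bs_rel z (x ** (b ^+ m)) e e.
  have := congr1 (fun g => g ^ (y ^+ m)) zxa.
  rewrite conjJg (bs_rel_iter m xy : _ ^ _ = _).
  by have := zy; rewrite /bs_rel !zpow1 => ->.
have : bs_rel z (x ** (b ^+ m)) e (- e).
  apply: bs_rel_invert_odd zx _; rewrite bE; lia.
rewrite /bs_rel zxb => ee; have := ztf (e - - e)%R.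
by rewrite zpowB -ee mulgV => /(_ erefl); lia.
Qed.

(** [w] fixes the even powers of [x] but inverts [y ^+ m], so conjugation by
    [y ^+ m] both carries [x ** P] to [x ** Q] and [x ** Q] to [x ** P]; comparing
    the two images of [x ** (P * Q)] gives [P ^ 2 = Q ^ 2]. *)
Lemma absz_eq_of_inverting_power x y w a b (m : nat) :
    bs_rel x y a b -> bs_rel y w m (- Posz m) -> bs_rel x w 2 2 ->
    (forall n, x ** n = 1 -> n = 0%R) -> (0 < m)%N ->
  `|a|%N = `|b|%N.
Proof.
move=> xy yw xw xtf m0; pose P := (a ^+ m * 2)%R; pose Q := (b ^+ m * 2)%R.
have xyPQ : bs_rel x (y ^+ m) P Q := bs_rel_mul 2 (bs_rel_iter m xy).
have fixw k : (x ** (k * 2)) ^ w = x ** (k * 2).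
  have := bs_rel_mul k xw; rewrite /bs_rel mulrC; exact.
have xyQP : bs_rel x (y ^+ m) Q P.
  rewrite -[y ^+ m]invgK; apply: bs_rel_swap.
  have := congr1 (fun g => g ^ w) xyPQ.
  by rewrite conjJg (yw : (y ^+ m) ^ w = _) !fixw zpowN.
have := bs_rel_mul P xyQP.
rewrite [(Q * P)%R]mulrC /bs_rel (bs_rel_mul Q xyPQ : _ ^ _ = _) => QP.
have /xtf : x ** (Q * Q - P * P) = 1 by rewrite zpowB QP mulgV.
have -> : (Q * Q - P * P = ((b ^+ m) ^+ 2 - (a ^+ m) ^+ 2) * 4)%R.
  by rewrite /P /Q; ring.
move/eqP; rewrite mulf_eq0 orbF subr_eq0 -!exprM => /eqP /(congr1 absz) /eqP.
by rewrite !abszX eqn_exp2r ?muln_gt0 ?m0 // => /eqP.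
Qed.

(** If [d = -c] and [e] were odd, [z ** e] would invert a power of [y] while
    commuting with [x ** 2].  Once [e] is even in that case, [z ** e] commutes with
    a power of [y] whichever sign [d] has. *)
Lemma graded_triple_two_equal x y z a b c d e f :
    graded_triple x y z a b c d e f -> c != 0%R -> e != 0%R ->
    d = c \/ d = (- c)%R -> f = e \/ f = (- e)%R -> `|a|%N != `|b|%N ->
  (d = (- c)%R -> (2 %| e)%Z) /\ (f = (- e)%R -> (a = b %[mod 2])%Z).
Proof.
move=> [[xy yz zx] [gxy gyz gzx]] c0 e0 dc fe ab.
have xtf n : x ** n = 1 -> n = 0%R := graded_stable_free gzx.
have ztf n : z ** n = 1 -> n = 0%R := graded_stable_free gyz.
have e_even : d = (- c)%R -> (2 %| e)%Z.
  move=> dE; rewrite dE in yz; apply: contraNT ab => e2; apply/eqP.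
  have ywN := bs_rel_invert_odd (bs_rel_absN yz) e2.
  apply: absz_eq_of_inverting_power xy ywN _ xtf _.
    have zx2 : bs_rel z (x ** 2) e e.
      by case: fe zx => -> => [|/bs_rel_invert_sq //]; exact: bs_rel_commute.
    by apply/conjg_fixP/commgP/commute_sym; apply/commgP/conjg_fixP.
  by rewrite absz_gt0.
split=> // fE; rewrite fE in zx.
have yze : bs_rel y (z ** e) `|c|%N `|c|%N.
  case: dc => dE; rewrite dE in yz.
    exact: bs_rel_commute (bs_rel_absz yz).
  exact: bs_rel_invert_even (bs_rel_absN yz) (e_even dE).
have zey : bs_rel (z ** e) (y ^+ `|c|) 1 1.
  rewrite /bs_rel !zpow1.
  by apply/conjg_fixP/commgP/commute_sym; apply/commgP/conjg_fixP.
have c0' : (0 < `|c|)%N by rewrite absz_gt0.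
have ab2 := even_of_commuting_powers xy zx zey ztf e0 c0'.
have zey' : bs_rel (z ** e) (y^-1 ^+ `|c|) 1 1.
  by rewrite expVgn; exact: bs_rel_swap.
have ba2 := even_of_commuting_powers (bs_rel_swap xy) zx zey' ztf e0 c0'.
lia.
Qed.

End Generic.

(** * Groups of permutations *)

(** Permutations of a possibly infinite type; the inverse is part of the data and
    is determined by the permutation. *)
Record sym (T : Type) := Sym {
  sym_fun :> T -> T;
  sym_inv : T -> T;
  sym_funK : cancel sym_fun sym_inv;
  sym_invK : cancel sym_inv sym_fun }.

HB.instance Definition _ T := gen_eqMixin (sym T).
HB.instance Definition _ T := gen_choiceMixin (sym T).

Section SymGroup.
Variable T : Type.
Implicit Types g h k : sym T.

Lemma symP g h : (forall v, g v = h v) -> g = h.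
Proof.
case: g h => [g g' gK g'K] [h h' hK h'K] /= /funext gh; subst h.
have gh' : g' = h' by apply/funext => v; rewrite -[v in LHS]h'K gK.
by subst h'; congr Sym; exact: Prop_irrelevance.
Qed.

Definition sym_one : sym T := @Sym T id id (fun=> erefl) (fun=> erefl).
Definition sym_mul g h : sym T := Sym
  (can_comp (sym_funK g) (sym_funK h)) (can_comp (sym_invK h) (sym_invK g)).
Definition sym_opp g : sym T := Sym (sym_invK g) (sym_funK g).

Fact sym_mulA : associative sym_mul. Proof. by move=> g h k; exact: symP. Qed.
Fact sym_mul1g : left_id sym_one sym_mul. Proof. by move=> g; exact: symP. Qed.
Fact sym_mulg1 : right_id sym_one sym_mul. Proof. by move=> g; exact: symP. Qed.
Fact sym_mulVg : left_inverse sym_one sym_opp sym_mul.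
Proof. by move=> g; apply: symP => v; exact: sym_funK. Qed.
Fact sym_mulgV : right_inverse sym_one sym_opp sym_mul.
Proof. by move=> g; apply: symP => v; exact: sym_invK. Qed.

HB.instance Definition _ := isGroup.Build (sym T)
  sym_mulA sym_mul1g sym_mulg1 sym_mulVg sym_mulgV.

Lemma symM g h v : (g * h) v = g (h v). Proof. by []. Qed.
Lemma sym1 v : (1 : sym T) v = v. Proof. by []. Qed.

Section Flow.
Variable F : int -> T -> T.
Hypothesis F0 : forall v, F 0 v = v.
Hypothesis FD : forall m n v, F (m + n)%R v = F m (F n v).

Fact flow_subproof n : cancel (F n) (F (- n)%R).
Proof. by move=> v; rewrite -FD addNr F0. Qed.

Fact flow_subproof' n : cancel (F (- n)%R) (F n).
Proof. by move=> v; rewrite -FD subrr F0. Qed.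

Definition flow n : sym T := Sym (flow_subproof n) (flow_subproof' n).

Lemma flowE n : flow 1%R ** n = flow n.
Proof.
symmetry; apply: zpow_unique => [k|]; apply: symP => v //=; exact: FD.
Qed.

End Flow.
End SymGroup.

Section LeftRegular.
Variable K : groupType.

Definition lsym (g : K) : sym K := Sym (mulKg g) (mulVKg g).

Lemma lsymM : {morph lsym : g h / g * h}.
Proof. by move=> g h; apply: symP => v /=; rewrite mulgA. Qed.

Lemma lsym_inj g : lsym g = 1 -> g = 1.
Proof. by move/(congr1 (fun k : sym K => k 1)); rewrite /= mulg1. Qed.

End LeftRegular.

(** * Homomorphisms from presented groups *)

Section Morph.
Variables (K H : groupType) (phi : K -> H).
Hypothesis phiM : {morph phi : g h / g * h}.

Lemma morph_one : phi 1 = 1.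
Proof. by apply: (mulgI (phi 1)); rewrite -phiM !mulg1. Qed.

Lemma morph_inv g : phi g^-1 = (phi g)^-1.
Proof. by apply: (mulgI (phi g)); rewrite -phiM !mulgV morph_one. Qed.

Lemma morph_injective : (forall g, phi g = 1 -> g = 1) -> injective phi.
Proof.
move=> ker g h gh; apply: divg1_eq; apply: ker.
by rewrite phiM morph_inv gh mulgV.
Qed.

Lemma morph_zpow g n : phi (g ** n) = phi g ** n.
Proof.
apply: (zpow_unique (h := fun n => phi (g ** n))) => [k|].
  by rewrite zpowS phiM.
exact: morph_one.
Qed.

Lemma morph_bs_rel s t m n : bs_rel s t m n -> bs_rel (phi s) (phi t) m n.
Proof.
by move=> st; rewrite /bs_rel -!morph_zpow -st !conjgE !phiM morph_inv.
Qed.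

Lemma morph_weval (X : choiceType) (h : X -> K) w :
  phi (weval h w) = weval (phi \o h) w.
Proof.
elim: w => [|[g s] w IH]; first by rewrite /weval !big_nil morph_one.
move: IH; rewrite /weval !big_cons phiM => ->.
by case: s; rewrite //= morph_inv.
Qed.

End Morph.

Lemma weval_ext (X : choiceType) (H : groupType) (h h' : X -> H) w :
  h =1 h' -> weval h w = weval h' w.
Proof. by move=> hh'; apply: eq_bigr => l _; rewrite hh'. Qed.

Lemma weval_wpow (X : choiceType) (H : groupType) (h : X -> H) g n :
  weval h (wpow g n) = h g ** n.
Proof.
have nseqE s k : weval h (nseq k (g, s)) = (if s then (h g)^-1 else h g) ^+ k.
  elim: k => [|k IH]; first by rewrite /weval big_nil.
  by rewrite expgS -IH /weval big_cons.
by case: n => k; rewrite nseqE //= expVgn.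
Qed.

Lemma weval_pgen_id (X : choiceType) (E : seq (word X * word X)) w :
  weval (pgen E) w = wclass E w.
Proof.
rewrite (weval_pgen E (fun g => g)) -[RHS](congr1 (wclass E) (map_id w)).
by congr wclass; apply: eq_map => -[].
Qed.

Lemma weval_bs_eqn (X : choiceType) (H : groupType) (h : X -> H) s t m n :
  weval h (bs_eqn s t m n).1 = weval h (bs_eqn s t m n).2 <->
  bs_rel (h s) (h t) m n.
Proof.
rewrite /bs_eqn /fst /snd !weval_cat !weval_wpow.
by rewrite [_ ** (-1)]zpowN !zpow1.
Qed.

Lemma pgen_bs_rel (X : choiceType) (E : seq (word X * word X)) s t m n :
  bs_eqn s t m n \in E -> bs_rel (pgen E s) (pgen E t) m n.
Proof.
by move=> st; apply/weval_bs_eqn; rewrite !weval_pgen_id; apply/wclassP/WordRel.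
Qed.

Definition bs_map (H : groupType) (s t : H) (g : bs_gen) : H :=
  match g with Base => s | Stable => t end.

Section BSHom.
Variables (m n : int).
Local Notation base := (pgen [:: bs_eqn Base Stable m n] Base : BS m n).
Local Notation stable := (pgen [:: bs_eqn Base Stable m n] Stable : BS m n).

Definition bs_hom (H : groupType) (s t : H) (p : BS m n) : H :=
  pres_lift (bs_map s t) p.

Lemma bs_gens_rel : bs_rel base stable m n.
Proof. by apply: pgen_bs_rel; rewrite inE. Qed.

Lemma bs_hom_eqn (H : groupType) (s t : H) : bs_rel s t m n ->
  forall u v, (u, v) \in [:: bs_eqn Base Stable m n] ->
    weval (bs_map s t) u = weval (bs_map s t) v.
Proof.
move=> st u v; rewrite inE => /eqP[-> ->].
exact/(weval_bs_eqn (bs_map s t) Base Stable).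
Qed.

Lemma bs_homM (H : groupType) (s t : H) :
  bs_rel s t m n -> {morph bs_hom s t : p q / p * q}.
Proof. by move=> st; exact: pres_liftM (bs_hom_eqn st). Qed.

Lemma bs_hom_base (H : groupType) (s t : H) :
  bs_rel s t m n -> bs_hom s t base = s.
Proof. by move=> st; exact: (pres_lift_gen (bs_hom_eqn st) Base). Qed.

Lemma bs_hom_stable (H : groupType) (s t : H) :
  bs_rel s t m n -> bs_hom s t stable = t.
Proof. by move=> st; exact: (pres_lift_gen (bs_hom_eqn st) Stable). Qed.

Lemma bs_hom_id p : bs_hom base stable p = p.
Proof.
rewrite -[RHS]wclass_repr -weval_pgen_id /bs_hom /pres_lift.
by apply: weval_ext => -[].
Qed.

Lemma bs_hom_unique (H : groupType) (phi : BS m n -> H) p :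
  {morph phi : g h / g * h} -> phi p = bs_hom (phi base) (phi stable) p.
Proof.
move=> phiM; rewrite -[p in LHS]bs_hom_id /bs_hom /pres_lift morph_weval //.
by apply: weval_ext => -[].
Qed.

End BSHom.

Arguments bs_hom {m n H}.

(** * Developability in terms of triples in arbitrary groups *)

Fact shiftD (m n v : int) : (v + (m + n) = v + n + m)%R. Proof. lia. Qed.

Definition shift : sym int :=
  @flow _ (fun n v => v + n)%R (@addr0 int) shiftD 1%R.

Lemma shiftE n v : (shift ** n) v = (v + n)%R.
Proof. by rewrite /shift flowE. Qed.

Lemma shift_free n : shift ** n = 1 -> n = 0%R.
Proof. by move/(congr1 (fun g : sym int => g 0%R)); rewrite shiftE add0r. Qed.

Lemma bs_rel_one (H : groupType) (t : H) m n : bs_rel 1 t m n.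
Proof. by rewrite /bs_rel !zpow_one conj1g. Qed.

(** The homomorphism to the integers killing the Base letter computes the stable
    exponent of any element of the Baumslag-Solitar group. *)
Lemma graded_of_injective (H : groupType) (s t : H) m n :
  bs_rel s t m n -> injective (bs_hom s t : BS m n -> H) -> graded s t.
Proof.
move=> st inj k.
have hM := bs_homM st.
have kM := bs_homM (bs_rel_one shift m n).
suff lift g j : height s t g j -> exists2 p : BS m n, bs_hom s t p = g
    & bs_hom 1 shift p = shift ** j.
  case/lift=> p p1 pk; apply: shift_free; rewrite -pk.
  by rewrite -(morph_one hM) in p1; rewrite (inj _ _ p1) (morph_one kM).
elim=> {g j} [||g h i j _ [p <- pi] _ [q <- qj]|g i _ [p <- pi]].
- exists (pgen _ Base); first exact: (bs_hom_base st).
  exact: (bs_hom_base (bs_rel_one _ _ _)).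
- exists (pgen _ Stable); first exact: (bs_hom_stable st).
  by rewrite zpow1; exact: (bs_hom_stable (bs_rel_one _ _ _)).
- by exists (p * q); rewrite ?hM // kM pi qj zpowD.
- by exists p^-1; rewrite ?(morph_inv hM) // (morph_inv kM) pi zpowN.
Qed.

Section Developable.
Variables a b c d e f : int.
Local Notation E := (tri_eqns a b c d e f).
Local Notation G := (tri_group a b c d e f).
Local Notation X := (pgen E GenX : G).
Local Notation Y := (pgen E GenY : G).
Local Notation Z := (pgen E GenZ : G).

Lemma tri_gens_rel : tri_rel X Y Z a b c d e f.
Proof. by split; apply: pgen_bs_rel; rewrite !inE eqxx ?orbT. Qed.

Lemma vertex_xy_hom p : @vertex_xy a b c d e f p = bs_hom X Y p.
Proof. by apply: weval_ext => -[]. Qed.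
Lemma vertex_yz_hom p : @vertex_yz a b c d e f p = bs_hom Y Z p.
Proof. by apply: weval_ext => -[]. Qed.
Lemma vertex_zx_hom p : @vertex_zx a b c d e f p = bs_hom Z X p.
Proof. by apply: weval_ext => -[]. Qed.

Lemma developable_graded : developable a b c d e f ->
  graded_triple X Y Z a b c d e f.
Proof.
have [xy yz zx] := tri_gens_rel.
case=> ixy iyz izx; split=> //; split.
- apply: graded_of_injective xy _ => p q.
  by rewrite -!vertex_xy_hom; exact: ixy.
- apply: graded_of_injective yz _ => p q.
  by rewrite -!vertex_yz_hom; exact: iyz.
- apply: graded_of_injective zx _ => p q.
  by rewrite -!vertex_zx_hom; exact: izx.
Qed.

Definition tri_map (H : groupType) (x y z : H) (g : tri_gen) : H :=
  match g with GenX => x | GenY => y | GenZ => z end.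

Lemma tri_hom_exists (H : groupType) (x y z : H) : tri_rel x y z a b c d e f ->
  exists phi : G -> H,
    [/\ {morph phi : g h / g * h}, phi X = x, phi Y = y & phi Z = z].
Proof.
case=> xy yz zx.
have hE u v : (u, v) \in E -> weval (tri_map x y z) u = weval (tri_map x y z) v.
  by rewrite !inE => /or3P[] /eqP[-> ->];
    [ apply/(weval_bs_eqn _ GenX GenY) | apply/(weval_bs_eqn _ GenY GenZ)
    | apply/(weval_bs_eqn _ GenZ GenX)].
exists (pres_lift (tri_map x y z)); split; first exact: pres_liftM.
- exact: (pres_lift_gen hE GenX).
- exact: (pres_lift_gen hE GenY).
- exact: (pres_lift_gen hE GenZ).
Qed.

End Developable.

(** The vertex group <x,y> injects, stated without reference to the presented
    triangle group, so that the three vertices are exchanged by rotating the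
    arguments. *)
Definition detected (a b c d e f : int) : Prop :=
  forall p : BS a b,
    (forall (H : groupType) (x y z : H),
       tri_rel x y z a b c d e f -> bs_hom x y p = 1) ->
  p = 1.

Lemma tri_rel_rot (H : groupType) (x y z : H) a b c d e f :
  tri_rel x y z a b c d e f -> tri_rel y z x c d e f a b.
Proof. by case. Qed.

Lemma developable_of_detected a b c d e f :
  detected a b c d e f -> detected c d e f a b -> detected e f a b c d ->
  developable a b c d e f.
Proof.
have [xy yz zx] := tri_gens_rel a b c d e f.
have ker (m n : int) (H K : groupType) (s t : H) (phi : H -> K) (p : BS m n) :
    bs_rel s t m n -> {morph phi : g h / g * h} ->
    bs_hom s t p = 1 -> bs_hom (phi s) (phi t) p = 1.
  move=> st phiM p1; rewrite -(morph_one phiM) -p1.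
  have := bs_homM st => sM.
  have : {morph phi \o (bs_hom s t : BS m n -> H) : g h / g * h}.
    by move=> g h /=; rewrite sM phiM.
  by move/(bs_hom_unique p) => /=; rewrite bs_hom_base // bs_hom_stable.
move=> dxy dyz dzx; split; apply: morph_injective => [|p] //; try exact: gmulfM.
- rewrite vertex_xy_hom => p1; apply: dxy => H x y z rel.
  by have [phi [phiM <- <- _]] := tri_hom_exists rel; exact: ker p1.
- rewrite vertex_yz_hom => p1; apply: dyz => H x y z rel.
  have [phi [phiM _ <- <-]] := tri_hom_exists (tri_rel_rot (tri_rel_rot rel)).
  exact: ker p1.
- rewrite vertex_zx_hom => p1; apply: dzx => H x y z rel.
  have [phi [phiM <- _ <-]] := tri_hom_exists (tri_rel_rot rel).
  exact: ker p1.
Qed.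

(** * Detection by retractions and involutions *)

Local Notation bs_base m n :=
  (pgen [:: bs_eqn Base Stable m n] Base : BS m n).
Local Notation bs_stable m n :=
  (pgen [:: bs_eqn Base Stable m n] Stable : BS m n).

Lemma detected_killing_z (a b c d e f : int) : d = c -> detected a b c d e f.
Proof.
move=> -> p /(_ (BS a b) (bs_base a b) (bs_stable a b) 1).
rewrite bs_hom_id; apply; split; first exact: bs_gens_rel.
  exact: conjg1.
exact: bs_rel_one.
Qed.

Lemma bs_rel_pm (H : groupType) (s t : H) m n :
  n = m \/ n = (- m)%R -> bs_rel s t m n -> bs_rel s t^-1 m n.
Proof.
case=> -> st; first exact: bs_rel_swap.
by have := bs_rel_opp (bs_rel_swap st); rewrite opprK.
Qed.

(** When [b = a] or [b = -a], fixing [x] and inverting [y] is an automorphism of the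
    vertex group; [z] acts as this automorphism and [x], [y] as left translations,
    all on the vertex group itself. *)
Lemma detected_by_involution (a b c d e f : int) :
  b = a \/ b = (- a)%R -> d = (- c)%R -> (e = f %[mod 2])%Z ->
  detected a b c d e f.
Proof.
move=> ab -> ef p; set X := bs_base a b; set Y := bs_stable a b.
have XY : bs_rel X Y^-1 a b := bs_rel_pm ab (bs_gens_rel a b).
pose sg : BS a b -> BS a b := bs_hom X Y^-1.
have sgM : {morph sg : g h / g * h} := bs_homM XY.
have sgX : sg X = X := bs_hom_base XY.
have sgY : sg Y = Y^-1 := bs_hom_stable XY.
have sgK : involutive sg.
  have M2 : {morph sg \o sg : g h / g * h} by move=> g h /=; rewrite !sgM.
  move=> g; have /= -> := bs_hom_unique g M2.
  rewrite !sgX sgY morph_inv // sgY invgK.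
  exact: bs_hom_id.
pose S : sym (BS a b) := Sym sgK sgK.
have SS : S * S = 1 by apply: symP => v; exact: sgK.
have Sconj g : lsym g ^ S = lsym (sg g).
  by apply: symP => v; rewrite conjgE !symM /= sgM sgK.
move=> /(_ _ (lsym X) (lsym Y) S) kill; apply: lsym_inj.
rewrite (bs_hom_unique p (@lsymM _)); apply: kill; split.
- exact (morph_bs_rel (@lsymM (BS a b)) (bs_gens_rel a b)).
- by rewrite /bs_rel zpowJ Sconj sgY (morph_inv (@lsymM _)) zpowV zpowN.
- have SX : commute S (lsym X).
    by apply/commute_sym/commgP/conjg_fixP; rewrite Sconj sgX.
  rewrite /bs_rel; have -> : (S ** e) ^ lsym X = S ** e.
    by rewrite zpowJ; congr (_ ** _); apply/conjg_fixP/commgP.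
  exact: zpow_mod2.
Qed.

Section TwoSheets.
Variable K : groupType.

(** With [exchange] below, this realizes the wreath product of [K] by a group of
    order 2, as permutations of two copies of [K]. *)
Definition sheets (u : K * K) (v : K * bool) : K * bool :=
  ((if v.2 then u.1 else u.2) * v.1, v.2).

Fact sheets_cancel u : cancel (sheets u) (sheets u^-1).
Proof. by case: u => g h [v []]; rewrite /sheets /= mulKg. Qed.

Fact sheets_cancel' u : cancel (sheets u^-1) (sheets u).
Proof. by case: u => g h [v []]; rewrite /sheets /= mulVKg. Qed.

Definition sheets_sym u : sym (K * bool) :=
  Sym (sheets_cancel u) (sheets_cancel' u).

Lemma sheets_symM : {morph sheets_sym : u v / u * v}.
Proof.
move=> [g h] [g' h']; apply: symP => -[v []];
by rewrite /= /sheets /= mulgA.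
Qed.

Fact exchangeK : involutive (fun v : K * bool => (v.1, ~~ v.2)).
Proof. by case=> v []. Qed.

Definition exchange : sym (K * bool) := Sym exchangeK exchangeK.

Lemma exchange_sq : exchange * exchange = 1.
Proof. by apply: symP => v; exact: exchangeK. Qed.

Lemma sheets_conj g h : sheets_sym (g, h) ^ exchange = sheets_sym (h, g).
Proof. by apply: symP => -[v []]. Qed.

End TwoSheets.

(** In general no automorphism of the vertex group inverts [y].  Let [x] act on the
    first of two copies only, [y] on both but inversely on the second, and let [z]
    exchange the copies: then [z] inverts [y], and the first copy is faithful. *)
Lemma detected_by_exchange (a b c d e f : int) :
  d = (- c)%R -> (2 %| e)%Z -> (2 %| f)%Z -> detected a b c d e f.
Proof.
move=> -> e2 f2 p; set X := bs_base a b; set Y := bs_stable a b.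
pose K : groupType := (BS a b * BS a b)%type.
pose x : K := (X, 1); pose y : K := (Y, Y^-1).
have fstM : {morph (fst : K -> BS a b) : u v / u * v} by [].
have sndM : {morph (snd : K -> BS a b) : u v / u * v} by [].
have xy : bs_rel x y a b.
  apply: injective_projections.
    rewrite (morph_zpow fstM x b) -[RHS](bs_gens_rel a b).
    by rewrite -(morph_zpow fstM x a).
  rewrite (morph_zpow sndM x b) zpow_one -[RHS](conj1g Y^-1).
  by rewrite -[1 in RHS](zpow_one _ a) -(morph_zpow sndM x a).
move=> /(_ _ (sheets_sym x) (sheets_sym y) (exchange _)) kill.
have {}kill : bs_hom (sheets_sym x) (sheets_sym y) p = 1.
  apply: kill; split.
  - exact (morph_bs_rel (@sheets_symM (BS a b)) xy).
  - rewrite /bs_rel zpowJ sheets_conj zpowN -zpowV.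
    rewrite -(morph_inv (@sheets_symM _)).
    by congr (sheets_sym _ ** _); congr (_, _); rewrite invgK.
  - by rewrite /bs_rel !(zpow_even (exchange_sq _)) ?conj1g.
have homM := bs_homM xy.
have sM : {morph (@sheets_sym (BS a b) : K -> _) \o
                 (bs_hom x y : BS a b -> K) : g h / g * h}.
  by move=> g h /=; rewrite homM sheets_symM.
have fM : {morph (fst : K -> BS a b) \o
                 (bs_hom x y : BS a b -> K) : g h / g * h}.
  by move=> g h /=; rewrite homM.
have /= pE := bs_hom_unique p fM.
have /= := bs_hom_unique p sM.
rewrite !(bs_hom_base xy) !(bs_hom_stable xy) kill in pE *.
move/(congr1 (fun g : sym (BS a b * bool) => (g (1, true)).1)).
by rewrite /= mulg1 pE bs_hom_id.
Qed.

(** * Detection when the Base powers are normal *)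

Section Syllables.
Variables (H : groupType) (s t : H).

Fixpoint syllables (l : seq (int * int)) : H :=
  if l is (n, k) :: l' then t ** n * (s ** k * syllables l') else 1.

End Syllables.

Lemma morph_syllables (K H : groupType) (phi : K -> H) (s t : K) l :
  {morph phi : g h / g * h} ->
  phi (syllables s t l) = syllables (phi s) (phi t) l.
Proof.
move=> phiM; elim: l => [|[n k] l IH] /=; first exact: morph_one.
by rewrite !phiM !(morph_zpow phiM) IH.
Qed.

(** The last exponent of the Base letter is unrestricted: it is the tail of the
    normal form. *)
Fixpoint reduced (a : int) (l : seq (int * int)) : bool :=
  if l is (n, k) :: l' then
    [&& n != 0%R, nilp l' || ~~ (a %| k)%Z & reduced a l']
  else true.

Section NormalForm.
Variables a b : int.
Hypothesis ab : b = a \/ b = (- a)%R.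
Local Notation X := (bs_base a b).
Local Notation Y := (bs_stable a b).

(** The powers of [x] divisible by [a] slide past [y], so an inner exponent of [x]
    divisible by [a] is moved to the front and the two adjacent powers of [y] merge,
    possibly cancelling. *)
Lemma syllables_stable (H : groupType) (x y : H) (k n : int) l :
    bs_rel x y a b -> reduced a l -> n = 1%R \/ n = (-1)%R ->
  exists k' l', reduced a l' /\
    y ** n * (x ** k * syllables x y l) = x ** k' * syllables x y l'.
Proof.
move=> xy lr n1; have n0 : n != 0%R by case: n1 => ->.
have [ak|ak] := boolP (a %| k)%Z; last first.
  exists 0%R, ((n, k) :: l); rewrite /= n0 ak orbT mul1g; split=> //.
case: l lr => [|[m j] l] /=.
  by exists 0%R, [:: (n, k)]; rewrite /= n0 mul1g.
case/and3P=> m0 jl lr.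
have [k' kE] : exists k', y ** n * x ** k = x ** k' * y ** n.
  have yx i : bs_rel x (y ** n) (a * i) (b * i).
    apply: bs_rel_mul; case: n1 => ->; first by rewrite zpow1.
    by rewrite zpowN zpow1; exact: bs_rel_pm.
  have {}ak : (b %| k)%Z.
    by move: ak; rewrite !dvdzE; case: ab => ->; rewrite ?abszN.
  case/dvdzP: ak => i ->; exists (a * i)%R.
  by rewrite mulrC -(yx i : _ ^ _ = _) -conjgC.
rewrite !mulgA kE -(mulgA (x ** k')) -zpowD -!mulgA.
have [nm0|nm0] := eqVneq (n + m)%R 0%R.
  by exists (k' + j)%R, l; rewrite nm0 [y ** 0]expg0 mul1g zpowD mulgA.
by exists k', (((n + m)%R, j) :: l); rewrite /= nm0 jl lr.
Qed.

Lemma normal_form (p : BS a b) :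
  exists k l, reduced a l /\ p = X ** k * syllables X Y l.
Proof.
have xy := bs_gens_rel a b.
rewrite -[p]wclass_repr -weval_pgen_id.
elim: (repr p) => [|[g s] w [k [l [lr IH]]]].
  by exists 0%R, [::]; rewrite /weval big_nil mulg1.
rewrite /weval big_cons -/(weval _ _) IH /=; case: g.
  have -> : (if s then X^-1 else X) = X ** (if s then -1 else 1)%R.
    by case: s; rewrite ?zpowN zpow1.
  by exists ((if s then -1 else 1) + k)%R, l; rewrite zpowD mulgA.
have -> : (if s then Y^-1 else Y) = Y ** (if s then -1 else 1)%R.
  by case: s; rewrite ?zpowN zpow1.
have [|k' [l' [l'r E]]] :=
  syllables_stable (n := if s then (-1)%R else 1%R) k xy lr.
  by case: (s); [right | left].
by exists k', l'; split=> //; exact: E.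
Qed.

End NormalForm.

(** Let [x] have order dividing [a], let [y] act as [1 + X] with [X * X = 0], and
    let [z] scale [X] by [d / c], so that [(y ** c) ^ z = y ** d].  A vector has
    three indices.  The index [i] counts the factors [X] and is what isolates the
    product of all the factors [X] of a reduced word.  The index [j] is the weight
    on which [z] acts, by [(d / c) ^ j]; [X] shifts it by 1, and [x] multiplies it by
    the sign [ep], so that [x] inverts [z] when [ep = -1].  The residue [s] is
    rotated by [x] and is reset to 0 by [X], which vanishes when [s = 0]: hence
    [X * X = 0], while [X * x ** k * X] is nonzero unless [a] divides [k].  The
    rotation is by 2 modulo [2 * |a|], so that odd residues never meet 0 and serve
    as starting points even when [|a| = 1]. *)
Section Representation.
Variables a ep : int.
Hypothesis a0 : a != 0%R.
Hypothesis ep1 : (ep * ep = 1)%R.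

Definition space : Type := nat -> int -> 'Z_(2 * `|a|) -> rat.

Lemma spaceP (v w : space) : (forall i j s, v i j s = w i j s) -> v = w.
Proof.
by move=> vw; apply/funext => i; apply/funext => j; apply/funext => s.
Qed.

Definition xact (k : int) (v : space) : space :=
  fun i j s => v i (ep ^ k * j)%R (s + (2 * k)%:~R)%R.

Definition yact (n : int) (v : space) : space :=
  fun i j s => (v i j s + n%:~R * (if s != 0 then v i.+1 (j + 1) 0 else 0))%R.

Lemma ep_unit : ep \is a GRing.unit.
Proof. by apply/unitrPr; exists ep. Qed.

Fact xact0 v : xact 0 v = v.
Proof. by apply: spaceP => i j s; rewrite /xact expr0z mul1r mulr0 addr0. Qed.

Fact xactD m n v : xact (m + n)%R v = xact m (xact n v).
Proof.
apply: spaceP => i j s; rewrite /xact.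
rewrite exprzDr ?ep_unit // mulrDr rmorphD /= addrA mulrA.
by rewrite [(ep ^ n * _)%R]mulrC.
Qed.

Fact yact0 v : yact 0 v = v.
Proof. by apply: spaceP => i j s; rewrite /yact mul0r addr0. Qed.

Fact yactD m n v : yact (m + n)%R v = yact m (yact n v).
Proof.
apply: spaceP => i j s; rewrite /yact eqxx /=.
by case: (s != 0%R); rewrite !(mulr0, addr0) // rmorphD /= mulrDl addrAC addrA.
Qed.

Definition xsym : sym space := flow xact0 xactD 1%R.
Definition ysym : sym space := flow yact0 yactD 1%R.

Lemma xsymE k v : (xsym ** k) v = xact k v.
Proof. by rewrite /xsym flowE. Qed.

Lemma ysymE k v : (ysym ** k) v = yact k v.
Proof. by rewrite /ysym flowE. Qed.

Definition layer (r : nat) : space := fun i _ _ => ((i == r)%:R)%R.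

Lemma syllables_cons_act n k l v i j s :
  syllables xsym ysym ((n, k) :: l) v i j s =
  (syllables xsym ysym l v i (ep ^ k * j) (s + (2 * k)%:~R) +
   n%:~R * (if s != 0
     then syllables xsym ysym l v i.+1 (ep ^ k * (j + 1)) (0 + (2 * k)%:~R)
     else 0))%R.
Proof.
rewrite -[LHS]/((ysym ** n) ((xsym ** k) (syllables xsym ysym l v)) i j s).
by rewrite ysymE /yact xsymE.
Qed.

(** Fewer than [r - i] syllables cannot raise the first index from [i] to [r]. *)
Lemma syllables_below r l i j s : (i + size l < r)%N ->
  syllables xsym ysym l (layer r) i j s = 0%R.
Proof.
elim: l i j s => [|[n k] l IH] i j s.
  by move=> /= il; rewrite /layer (_ : i == r = false) //; lia.
rewrite syllables_cons_act /= => il; rewrite !IH; try lia.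
by rewrite if_same mulr0 addr0.
Qed.

Lemma intr_Zp0 (p : nat) k : (1 < p)%N -> ((k%:~R : 'Z_p) == 0)%R = (p %| k)%Z.
Proof.
move=> p1; have natE (n : nat) : ((n%:R : 'Z_p) == 0)%R = (p %| n)%N.
  by rewrite -val_eqE /= val_Zp_nat.
by case: k => n; rewrite ?NegzE ?mulrNz ?oppr_eq0 natE dvdzE.
Qed.

Lemma rotation0 k : (((2 * k)%:~R : 'Z_(2 * `|a|)) == 0)%R = (a %| k)%Z.
Proof.
have a1 : (0 < `|a|)%N by rewrite absz_gt0.
rewrite intr_Zp0; last by lia.
by rewrite PoszM dvdz_mul2l // dvdzE.
Qed.

(** With exactly [r - i] syllables only the product of all the factors [X] reaches
    layer [r]; its coefficient is the product of the exponents of [y]. *)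
Lemma syllables_on_layer r l i j s :
    reduced a l -> (i + size l)%N = r ->
    nilp l || (s != 0%R) ->
  syllables xsym ysym l (layer r) i j s != 0%R.
Proof.
elim: l i j s => [|[n k] l IH] i j s.
  by move=> _ /= ir _; rewrite /layer -ir addn0 eqxx oner_neq0.
rewrite syllables_cons_act /= => /and3P[n0 kl lr] ir s0.
rewrite s0 syllables_below ?add0r; last by lia.
rewrite mulf_neq0 ?intr_eq0 //; apply: IH => //; first by lia.
by rewrite rotation0.
Qed.

Lemma representation_separates k l r : reduced a l -> size l = r ->
  xsym ** k * syllables xsym ysym l = 1 -> l = [::].
Proof.
(* This residue is carried by [x ** k] to 1. *)
pose s0 : 'Z_(2 * `|a|) := (1 - (2 * k)%:~R)%R.
move=> lr lE /(congr1 (fun g : sym space => g (layer r) 0%N 0%R s0)).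
rewrite symM xsymE /xact subrK sym1 => E.
case: l lr lE E => // nk l lr lE E.
have s1 : nilp (nk :: l) || (1 != 0 :> 'Z_(2 * `|a|))%R by rewrite oner_neq0.
have := syllables_on_layer (i := 0) (ep ^ k * 0)%R lr lE s1.
by rewrite E /layer -lE eqxx.
Qed.

Variables c d : int.
Hypotheses (c0 : c != 0%R) (d0 : d != 0%R).
Let lam : rat := (d%:~R / c%:~R)%R.

Lemma lam0 : lam != 0%R.
Proof. by rewrite /lam mulf_neq0 ?invr_eq0 ?intr_eq0. Qed.

Definition zact (n : int) (v : space) : space :=
  fun i j s => ((lam ^ j) ^ n * v i j s)%R.

Fact zact0 v : zact 0 v = v.
Proof. by apply: spaceP => i j s; rewrite /zact expr0z mul1r. Qed.

Fact zactD m n v : zact (m + n)%R v = zact m (zact n v).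
Proof.
apply: spaceP => i j s; rewrite /zact.
by rewrite expfzDr ?mulrA // expfz_neq0 // lam0.
Qed.

Definition zsym : sym space := flow zact0 zactD 1%R.

Lemma zsymE k v : (zsym ** k) v = zact k v.
Proof. by rewrite /zsym flowE. Qed.

Hypothesis ep_a : (ep ^ a = 1)%R.

Lemma xsym_order : xsym ** a = 1.
Proof.
apply: symP => v; rewrite xsymE; apply: spaceP => i j s.
rewrite /xact ep_a mul1r (_ : (2 * a)%:~R = 0)%R ?addr0 //.
by apply/eqP; rewrite rotation0 dvdzz.
Qed.

Lemma representation_rel b e f :
    b = a \/ b = (- a)%R -> f = (ep * e)%R ->
  tri_rel xsym ysym zsym a b c d e f.
Proof.
move=> ab fE; split.
- rewrite /bs_rel xsym_order conj1g.
  by case: ab => ->; rewrite ?zpowN xsym_order ?invg1.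
- rewrite /bs_rel; apply: (mulgI zsym); rewrite -conjgC.
  apply: symP => v; rewrite !symM !ysymE -[zsym]zpow1 !zsymE.
  apply: spaceP => i j s.
  rewrite /yact /zact !expr1z mulrDr; congr (_ + _)%R.
  case: (s != 0%R); last by rewrite !mulr0.
  rewrite expfzDr ?lam0 // expr1z /lam.
  have : (c%:~R != 0 :> rat)%R by rewrite intr_eq0.
  by move=> ?; field.
- rewrite /bs_rel; apply: (mulgI xsym); rewrite -conjgC.
  apply: symP => v; rewrite !symM !zsymE -[xsym]zpow1 !xsymE.
  apply: spaceP => i j s.
  rewrite /zact /xact expr1z fE; congr (_ * _)%R.
  by rewrite !exprz_exp mulrACA ep1 mul1r.
Qed.

End Representation.

(** The representation leaves only powers of [x] undetected, since it gives [x]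
    finite order.  For these, [x] acts on the integers by translation: with [y = 1]
    if [b = a], and with [y] the reflection if [b = -a], where [c = d] modulo 2
    makes the relation between [y] and [z = 1] hold. *)
Lemma detected_by_layers (a b c d e f : int) :
    a != 0%R -> c != 0%R -> d != 0%R ->
    b = a \/ b = (- a)%R /\ (c = d %[mod 2])%Z ->
    f = e \/ f = (- e)%R /\ (2 %| a)%Z ->
  detected a b c d e f.
Proof.
move=> a0 c0 d0 ab ef p kill.
have ab' : b = a \/ b = (- a)%R by case: ab => [|[]]; [left | right].
have [ep [ep1 epa fE]] : exists ep,
    [/\ (ep * ep = 1)%R, (ep ^ a = 1)%R & f = (ep * e)%R].
  case: ef => [->|[-> a2]]; first by exists 1%R; rewrite exp1rz !mul1r.
  exists (-1)%R; split; rewrite ?mulN1r ?opprK //.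
  by case/dvdzP: a2 => k ->; rewrite mulrC -exprz_exp exp1rz.
have [k [l [lr pE]]] := normal_form ab' p.
have evalE (H : groupType) (x y z : H) : tri_rel x y z a b c d e f ->
    x ** k * syllables x y l = 1.
  move=> rel; have [xy _ _] := rel; have hM := bs_homM xy.
  rewrite -(kill _ x y z rel) pE hM (morph_zpow hM) (morph_syllables _ _ _ hM).
  by rewrite (bs_hom_base xy) (bs_hom_stable xy).
have l0 : l = [::].
  apply: (representation_separates a0 (ep1 := ep1) (k := k) lr erefl).
  by apply: evalE; exact: (representation_rel a0 ep1 c0 d0 epa ab' fE).
suff k0 : k = 0%R by rewrite pE k0 l0 mulg1.
rewrite l0 in evalE; apply: shift_free; rewrite -[LHS]mulg1.
case: ab => [bE|[bE cd]].
  apply: (evalE _ shift 1 1); split; try exact: bs_rel_one.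
  by rewrite /bs_rel conjg1 bE.
pose neg : sym int := Sym (@opprK int) (@opprK int).
have nn : neg * neg = 1 by apply: symP => v; exact: opprK.
have negV : neg^-1 = neg by rewrite -[LHS]mulg1 -nn mulKg.
apply: (evalE _ shift neg 1); split; last exact: bs_rel_one.
  apply: symP => v; rewrite conjgE negV !symM !shiftE /= bE; lia.
by rewrite /bs_rel conjg1; exact: zpow_mod2.
Qed.

Local Close Scope group_scope.

(** * The exceptional parameters *)

(** The second disjunct merges the four exceptional forms with an arbitrary first
    pair: they combine independently a condition on the second pair and one on the
    third.  Both disjuncts are invariant under swapping and negating pairs. *)
Definition special (a b c d e f : int) : Prop :=
  (b = - a /\ d = - c /\ f = - e) \/
  (d = c \/ d = - c /\ (2 %| e)%Z) /\ (f = e \/ f = - e /\ (a = b %[mod 2])%Z).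

Definition special_rot (a b c d e f : int) : Prop :=
  [\/ special a b c d e f, special c d e f a b | special e f a b c d].

Definition special_params (p : params) : Prop :=
  let: ((a, b), (c, d), (e, f)) := p in special_rot a b c d e f.

Lemma trivial_move_special p q :
  trivial_move p q -> special_params q -> special_params p.
Proof.
case=> -[a b] [c d] [e f]; rewrite /special_params /special_rot /=.
  by case=> ?; [constructor 2 | constructor 3 | constructor 1].
all: case=> sp; [constructor 1 | constructor 2 | constructor 3].
all: move: sp; rewrite /special; lia.
Qed.

Lemma exceptional_special p : exceptional p -> special_params p.
Proof.
case=> q pq; elim: pq => {p q} [p|p q r pq _ IH /IH]; last first.
  exact: trivial_move_special.
case=> a [b [c [e [_ [->|->|[-> ab]|[[-> e2]|[-> e2 ab]]]]]]];
  constructor 1; rewrite /special; lia.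
Qed.

Lemma exceptional_cycle p q r : exceptional (q, r, p) -> exceptional (p, q, r).
Proof.
by case=> s qs ss; exists s => //; apply: MovesS qs; exact: MoveCycle.
Qed.

Lemma special_exceptional a b c d e f :
    a != 0 -> b != 0 -> c != 0 -> e != 0 ->
  special a b c d e f -> exceptional ((a, b), (c, d), (e, f)).
Proof.
move=> a0 b0 c0 e0 sp; exists ((a, b), (c, d), (e, f)); first exact: Moves0.
exists a, b, c, e; split=> //.
case: sp => [[-> [-> ->]]|[[->|[-> e2]] [->|[-> ab]]]].
- by constructor 1.
- by constructor 2.
- by constructor 3.
- by constructor 4; left.
- by constructor 4; right.
Qed.

Lemma special_detected a b c d e f :
    a != 0 -> b != 0 -> c != 0 -> d != 0 -> e != 0 -> f != 0 ->
    special a b c d e f ->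
  [/\ detected a b c d e f, detected c d e f a b & detected e f a b c d].
Proof.
move=> a0 b0 c0 d0 e0 f0 [[bE [dE fE]]|[cd ef]].
  by split; apply: detected_by_involution; rewrite ?bE ?dE ?fE //;
    try (by right); lia.
split; last 1 first.
- exact: detected_by_layers.
- case: cd => [|[dE e2]]; first exact: detected_killing_z.
  by apply: detected_by_exchange => //; lia.
- case: ef => [|[fE ab]]; first exact: detected_killing_z.
  by apply: detected_by_involution => //; lia.
Qed.

Lemma absz_eq_pm (m n : int) : `|m|%N = `|n|%N -> n = m \/ n = - m.
Proof. lia. Qed.

(** If one pair has equal entries and another has opposite ones, some pair with
    equal entries is followed cyclically by one with opposite entries; rotated to
    the second and third places they satisfy the second disjunct of [special], as
    the first pair has entries congruent modulo 2. *)
Lemma equal_special a b c d e f :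
    b = a \/ b = - a -> d = c \/ d = - c -> f = e \/ f = - e ->
  special_rot a b c d e f.
Proof.
case=> -> [] -> [] ->; rewrite /special_rot /special.
all: first [ by constructor 1; lia | by constructor 2; lia
           | by constructor 3; lia].
Qed.

(** A pair with entries equal up to sign satisfies the divisibility hypothesis, so
    one such pair, rotated to the first place, already brings the generic collapse
    into play unless a second one is present. *)
Lemma graded_triple_special (H : groupType) (x y z : H) a b c d e f :
    graded_triple x y z a b c d e f ->
    a != 0 -> b != 0 -> c != 0 -> d != 0 -> e != 0 -> f != 0 ->
    ((a %| b)%Z \/ (b %| a)%Z) \/ ((c %| d)%Z \/ (d %| c)%Z) \/
      ((e %| f)%Z \/ (f %| e)%Z) ->
  special_rot a b c d e f.
Proof.
move=> gxy a0 b0 c0 d0 e0 f0 dvd.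
have gyz := graded_triple_rot gxy; have gzx := graded_triple_rot gyz.
have dvd_of_absz m n : `|m|%N = `|n|%N -> (m %| n)%Z.
  by move=> mn; rewrite dvdzE mn.
have [ab|ab] := eqVneq `|a|%N `|b|%N; have [cd|cd] := eqVneq `|c|%N `|d|%N;
  have [ef|ef] := eqVneq `|e|%N `|f|%N.
- exact: equal_special (absz_eq_pm ab) (absz_eq_pm cd) (absz_eq_pm ef).
- have := graded_triple_two_equal gzx a0 c0 (absz_eq_pm ab) (absz_eq_pm cd) ef.
  constructor 3; have := absz_eq_pm ab; have := absz_eq_pm cd.
  by rewrite /special; tauto.
- have := graded_triple_two_equal gyz e0 a0 (absz_eq_pm ef) (absz_eq_pm ab) cd.
  constructor 2; have := absz_eq_pm ef; have := absz_eq_pm ab.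
  by rewrite /special; tauto.
- by case: (graded_triple_not_dvd gxy) => //; left; exact: dvd_of_absz.
- have := graded_triple_two_equal gxy c0 e0 (absz_eq_pm cd) (absz_eq_pm ef) ab.
  constructor 1; have := absz_eq_pm cd; have := absz_eq_pm ef.
  by rewrite /special; tauto.
- by case: (graded_triple_not_dvd gyz) => //; left; exact: dvd_of_absz.
- by case: (graded_triple_not_dvd gzx) => //; left; exact: dvd_of_absz.
- case: dvd => [|[]] dvd.
  + by case: (graded_triple_not_dvd gxy).
  + by case: (graded_triple_not_dvd gyz).
  + by case: (graded_triple_not_dvd gzx).
Qed.

Theorem theorem1 (a b c d e f : int)
  (a0 : a != 0) (b0 : b != 0) (c0 : c != 0)
  (d0 : d != 0) (e0 : e != 0) (f0 : f != 0)
  (hdvd : ((a %| b)%Z \/ (b %| a)%Z) \/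
          ((c %| d)%Z \/ (d %| c)%Z) \/
          ((e %| f)%Z \/ (f %| e)%Z)) :
  (~ exceptional ((a, b), (c, d), (e, f)) ->
     ~ developable a b c d e f) /\
  (exceptional ((a, b), (c, d), (e, f)) ->
     developable a b c d e f).
Proof.
split=> [nexc dev|/exceptional_special /= sp]; last first.
  case: sp => sp.
  - have [? ? ?] := special_detected a0 b0 c0 d0 e0 f0 sp.
    exact: developable_of_detected.
  - have [? ? ?] := special_detected c0 d0 e0 f0 a0 b0 sp.
    exact: developable_of_detected.
  - have [? ? ?] := special_detected e0 f0 a0 b0 c0 d0 sp.
    exact: developable_of_detected.
apply: nexc.
have gr := developable_graded dev.
case: (graded_triple_special gr a0 b0 c0 d0 e0 f0 hdvd) => sp.
- exact: special_exceptional.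
- exact/exceptional_cycle/special_exceptional.
- exact/exceptional_cycle/exceptional_cycle/special_exceptional.
Qed.
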